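(* Let $p\in(1,\infty)$, let $E$ be a Banach space, $X$ a Banach lattice and $T:E\to X$ a bounded linear operator. The following statements are equivalent: (1) $T$ is $(p,\infty)$-convex; (2) there exist a Banach lattice $Y$ with an upper $p$-estimate and a factorization $T=S\phi$, where $\phi:E\to Y$ is a bounded linear operator and $S:Y\to X$ is a lattice homomorphism. Moreover, in (2) one can take $Y=\mathrm{FBL}^{\uparrow p}[E]$, $\phi$ the canonical isometric embedding of $E$ into $\mathrm{FBL}^{\uparrow p}[E]$, and $S=\widehat T$ the (unique) lattice homomorphism with $\widehat T\phi=T$, and then $\|S\|\le\kappa K^{(p,\infty)}(T)$, with $\kappa$ depending only on $p$.
   Context: Banach spaces and lattices are real. $T:E\to X$ is $(p,\infty)$-convex if there is a constant $K$ with $\|\bigvee_{k=1}^n|Tx_k|\|\le K(\sum_{k=1}^n\|x_k\|^p)^{1/p}$ for all $x_1,\dots,x_n\in E$; the least such $K$ is $K^{(p,\infty)}(T)$. A Banach lattice $Y$ has an upper $p$-estimate with constant $C$ if $\|\bigvee_{k=1}^n|y_k|\|\le C(\sum_{k=1}^n\|y_k\|^p)^{1/p}$ for all $y_1,\dots,y_n\in Y$. $\mathrm{FBL}^{\uparrow p}[E]$ is the free Banach lattice with upper $p$-estimate (constant $1$) over $E$: the (unique up to lattice isometry, known to exist) Banach lattice $Z$ such that (i) $Z$ has an upper $p$-estimate with constant $1$; (ii) there is an isometric embedding $\psi:E\to Z$ such that the sublattice generated by $\psi(E)$ is dense in $Z$; (iii) for every bounded linear $R:E\to W$ into a Banach lattice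 $W$ with an upper $p$-estimate with constant $1$ there is a lattice homomorphism $\widehat R:Z\to W$ with $\widehat R\psi=R$ and $\|\widehat R\|=\|R\|$. *)

(* Defs.v *)
From HB Require Import structures.
From mathcomp Require Import all_boot all_order all_algebra.
From mathcomp Require Import all_classical all_reals all_analysis.
Set Implicit Arguments.
Unset Strict Implicit.
Unset Printing Implicit Defensive.
Import Order.TTheory GRing.Theory Num.Theory.
Import numFieldNormedType.Exports.
Local Open Scope classical_set_scope.
Local Open Scope ring_scope.

(* Real Banach spaces are [completeNormedModType R] with [R : realType].

   The join of CompleteNormedModule and Order.Lattice cannot be declared as a
   structure downstream of Num.RealDomain (Hierarchy Builder reports a missing
   join), so the mixin carries the raw lattice order, and the instances below
   equip every Banach lattice with its Order.Lattice structure.  The order gets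
   [ring_display]: [x <= y] is then the notation of [ring_scope] for vectors as
   well as for scalars. *)
HB.mixin Record isBanachLattice (R : realType) E & CompleteNormedModule R E := {
  bl_le : rel E;
  bl_meet : E -> E -> E;
  bl_join : E -> E -> E;
  bl_le_refl : reflexive bl_le;
  bl_le_anti : antisymmetric bl_le;
  bl_le_trans : transitive bl_le;
  bl_meetP : forall x y z, bl_le x (bl_meet y z) = bl_le x y && bl_le x z;
  bl_joinP : forall x y z, bl_le (bl_join x y) z = bl_le x z && bl_le y z;
  bl_leD2r : forall x y z : E, bl_le x y -> bl_le (x + z) (y + z);
  bl_leZ2l : forall (a : R) (x y : E),
    0 <= a -> bl_le x y -> bl_le (a *: x) (a *: y);
  bl_le_norm : forall x y : E,
    bl_le (bl_join x (- x)) (bl_join y (- y)) -> `|x| <= `|y|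
}.

#[short(type="banachLatticeType")]
HB.structure Definition BanachLattice (R : realType) :=
  { E of CompleteNormedModule R E & isBanachLattice R E }.

HB.instance Definition _ (R : realType) (X : banachLatticeType R) :=
  Order.Le_isPOrder.Build ring_display (BanachLattice.sort X)
    (@bl_le_refl R X) (@bl_le_anti R X) (@bl_le_trans R X).
HB.instance Definition _ (R : realType) (X : banachLatticeType R) :=
  Order.POrder_MeetJoin_isLattice.Build ring_display (BanachLattice.sort X)
    (@bl_meetP R X) (@bl_joinP R X).

Section BanachLatticeDefs.
Context {R : realType}.

(* The modulus |x| of the lattice, as opposed to the norm [`|x|]. *)
Definition modulus (X : banachLatticeType R) (x : X) : X := Order.join x (- x).

(* |x_1| \/ ... \/ |x_n|.  The base point 0 is harmless, since moduli are
   nonnegative; it only matters for n = 0, where the value is 0. *)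
Definition sup_modulus (X : banachLatticeType R) n (x : 'I_n -> X) : X :=
  \big[Order.join/0]_(k < n) modulus (x k).

Definition lp_sum (E : normedModType R) (p : R) n (x : 'I_n -> E) : R :=
  (\sum_(k < n) `|x k| `^ p) `^ p^-1.

Definition bounded_op (E F : normedModType R) (T : E -> F) : Prop :=
  exists K : R, forall x, `|T x| <= K * `|x|.

(* Meaningful for bounded T only (the infimum of the empty set is 0). *)
Definition opnorm (E F : normedModType R) (T : E -> F) : R :=
  inf [set K : R | 0 <= K /\ forall x, `|T x| <= K * `|x|].

Definition pinf_convex_with (p : R) (E : completeNormedModType R)
    (X : banachLatticeType R) (T : E -> X) (K : R) : Prop :=
  forall n (x : 'I_n -> E),
    `|sup_modulus (fun k => T (x k))| <= K * lp_sum p x.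

Definition pinf_convex (p : R) (E : completeNormedModType R)
    (X : banachLatticeType R) (T : E -> X) : Prop :=
  exists K : R, pinf_convex_with p T K.

(* The restriction to K >= 0 only matters when E = 0, where every real K is
   admissible.  Meaningful for (p,oo)-convex T only. *)
Definition pinf_const (p : R) (E : completeNormedModType R)
    (X : banachLatticeType R) (T : E -> X) : R :=
  inf [set K : R | 0 <= K /\ pinf_convex_with p T K].

Definition upper_p_estimate_with (p : R) (Y : banachLatticeType R) (C : R)
    : Prop :=
  forall n (y : 'I_n -> Y), `|sup_modulus y| <= C * lp_sum p y.

Definition upper_p_estimate (p : R) (Y : banachLatticeType R) : Prop :=
  exists C : R, upper_p_estimate_with p Y C.

(* Linearity is carried by the type of S. *)
Definition lattice_hom (Y X : banachLatticeType R) (S : {linear Y -> X})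
    : Prop :=
  {morph S : x y / Order.join x y} /\ {morph S : x y / Order.meet x y}.

Definition linear_sublattice (Z : banachLatticeType R) (A : set Z) : Prop :=
  [/\ A 0,
      forall (a : R) x y, A x -> A y -> A (a *: x + y),
      forall x y, A x -> A y -> A (Order.join x y) &
      forall x y, A x -> A y -> A (Order.meet x y)].

Definition generated_sublattice (Z : banachLatticeType R) (G : set Z) : set Z :=
  smallest (@linear_sublattice Z) G.

(* (Z, psi) is the free Banach lattice with upper p-estimate over E. *)
Definition is_FBL_up (p : R) (E : completeNormedModType R)
    (Z : banachLatticeType R) (psi : {linear E -> Z}) : Prop :=
  [/\ upper_p_estimate_with p Z 1,
      forall x, `|psi x| = `|x|,
      dense (generated_sublattice (range psi)) &
      forall (W : banachLatticeType R) (U : {linear E -> W}),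
        upper_p_estimate_with p W 1 -> bounded_op U ->
        exists V : {linear Z -> W},
          [/\ lattice_hom V, forall x, V (psi x) = U x,
              bounded_op V & opnorm V = opnorm U]].

Definition factors_through_upper_p_estimate (p : R)
    (E : completeNormedModType R) (X : banachLatticeType R)
    (T : {linear E -> X}) : Prop :=
  exists (Y : banachLatticeType R) (phi : {linear E -> Y})
         (S : {linear Y -> X}),
    [/\ upper_p_estimate p Y, bounded_op phi, lattice_hom S &
        forall x, T x = S (phi x)].

End BanachLatticeDefs.

(* Main.v *)
(* Let A be the set of all w in X with |w| <= |T x_1| \/ ... \/ |T x_n| for some
   x_k with sum_k |x_k|^p <= 1, and let C be the smallest closed convex solid
   subset of X containing A.  If T is (p,oo)-convex with constant K, then C lies
   in the ball of radius K.  Let Y be the span of C normed by the gauge of C; it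
   is an ideal of X, the inclusion S : Y -> X has norm at most K, and
   T : E -> Y has norm at most 1.
   If a^p + b^p <= 1, then A is stable under (v, w) |-> a |v| \/ b |w|; as this
   map is separately convex and monotone in |v| and |w|, C is stable under it
   too, which says exactly that Y has an upper p-estimate with constant 1.
   Applying the universal property of FBL^{up p}[E] to T : E -> Y then gives the
   last part with kappa = 1. *)
Require Import Defs.
From HB Require Import structures.
From mathcomp Require Import all_boot all_order all_algebra.
From mathcomp Require Import all_classical all_reals all_analysis.
Set Implicit Arguments.
Unset Strict Implicit.
Unset Printing Implicit Defensive.
Import Order.TTheory GRing.Theory Num.Theory.
Import numFieldNormedType.Exports.
Local Open Scope classical_set_scope.
Local Open Scope ring_scope.

(** * Order, modulus and norm in a Banach lattice *)

Section VectorLattice.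
Context {R : realType} {X : banachLatticeType R}.
Implicit Types (x y z w : X) (a b c : R).

Lemma blat_leD2r x y z : (x + z <= y + z) = (x <= y).
Proof.
apply/idP/idP => [h|]; last exact: bl_leD2r.
by have := @bl_leD2r R X _ _ (- z) h; rewrite !addrK.
Qed.

Lemma blat_leD2l x y z : (z + x <= z + y) = (x <= y).
Proof. by rewrite ![z + _]addrC blat_leD2r. Qed.

Lemma blat_leD x y z w : x <= y -> z <= w -> x + z <= y + w.
Proof.
by move=> xy zw; rewrite (@le_trans _ _ (y + z)) ?blat_leD2r ?blat_leD2l.
Qed.

Lemma blat_leBlDr x y z : (x - z <= y) = (x <= y + z).
Proof. by rewrite -[LHS](blat_leD2r _ _ z) subrK. Qed.

Lemma blat_subr_ge0 x y : (0 <= y - x) = (x <= y).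
Proof. by rewrite -(blat_leD2r 0 _ x) add0r subrK. Qed.

Lemma blat_leN2 x y : (- x <= - y) = (y <= x).
Proof. by rewrite -[LHS]blat_subr_ge0 opprK addrC blat_subr_ge0. Qed.

Lemma blat_leNl x y : (x <= - y) = (y <= - x).
Proof. by rewrite -{1}[x]opprK blat_leN2. Qed.

Lemma blat_leZ2l a x y : 0 <= a -> x <= y -> a *: x <= a *: y.
Proof. exact: bl_leZ2l. Qed.

Lemma blat_scale_ge0 a x : 0 <= a -> 0 <= x -> 0 <= a *: x.
Proof. by move=> a0 x0; rewrite -(scaler0 X a) blat_leZ2l. Qed.

Lemma blat_leZ2l_pos a x y : 0 < a -> (a *: x <= a *: y) = (x <= y).
Proof.
move=> a0; apply/idP/idP => [h|]; last exact/blat_leZ2l/ltW.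
have := @blat_leZ2l a^-1 _ _ _ h; rewrite !scalerA mulVf ?gt_eqF// !scale1r.
by apply; rewrite invr_ge0 ltW.
Qed.

Lemma joinZ a x y : 0 <= a ->
  a *: Order.join x y = Order.join (a *: x) (a *: y).
Proof.
rewrite le_eqVlt => /predU1P[<-|a0].
  by rewrite !scale0r joinxx.
apply/le_anti/andP; split.
  rewrite -(@blat_leZ2l_pos a^-1) ?invr_gt0// scalerA mulVf ?gt_eqF// scale1r.
  rewrite leUx -(blat_leZ2l_pos x _ a0) -(blat_leZ2l_pos y _ a0).
  rewrite !scalerA mulfV ?gt_eqF// !scale1r.
  by rewrite leUl leUr.
by rewrite leUx !blat_leZ2l ?leUl ?leUr// ltW.
Qed.

Lemma oppr_join x y : - Order.join x y = Order.meet (- x) (- y).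
Proof.
apply/le_anti/andP; split.
  by rewrite lexI !blat_leN2 leUl leUr.
rewrite blat_leNl leUx (blat_leNl x) (blat_leNl y).
by rewrite leIl leIr.
Qed.

Lemma meet_oppr_join x y : Order.meet x y = - Order.join (- x) (- y).
Proof. by rewrite oppr_join !opprK. Qed.

Lemma ler_modulus x : x <= modulus x.
Proof. exact: leUl. Qed.

Lemma lerN_modulus x : - x <= modulus x.
Proof. exact: leUr. Qed.

Lemma modulus_leP x y : (modulus x <= y) = (x <= y) && (- x <= y).
Proof. exact: leUx. Qed.

Lemma modulus_ge0 x : 0 <= modulus x.
Proof.
have h : 0 <= modulus x + modulus x.
  by rewrite -(subrr x) blat_leD ?ler_modulus ?lerN_modulus.
rewrite -(@blat_leZ2l_pos 2)// scaler0.
by rewrite (_ : (2 : R) = 1 + 1) // scalerDl scale1r.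
Qed.

Lemma modulusN x : modulus (- x) = modulus x.
Proof. by rewrite /modulus opprK joinC. Qed.

Lemma modulus_id x : 0 <= x -> modulus x = x.
Proof.
move=> x0; apply/join_l; apply: (@le_trans _ _ 0) => //.
by rewrite -oppr0 blat_leN2 x0.
Qed.

Lemma le_modulus x y : 0 <= x -> x <= y -> modulus x <= modulus y.
Proof. by move=> x0 xy; rewrite modulus_id// (le_trans xy)// ler_modulus. Qed.

Lemma modulusK x : modulus (modulus x) = modulus x.
Proof. exact/modulus_id/modulus_ge0. Qed.

Lemma modulus0 : modulus (0 : X) = 0.
Proof. exact: modulus_id. Qed.

Lemma modulusD x y : modulus (x + y) <= modulus x + modulus y.
Proof.
by rewrite modulus_leP opprD !blat_leD ?ler_modulus ?lerN_modulus.
Qed.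

Lemma modulusZ a x : modulus (a *: x) = `|a| *: modulus x.
Proof.
case: ger0P => a0; first by rewrite /modulus joinZ// scalerN.
by rewrite -modulusN -scaleNr /modulus joinZ ?scalerN// oppr_ge0 ltW.
Qed.

Lemma le_norm_modulus x y : modulus x <= modulus y -> `|x| <= `|y|.
Proof. exact: bl_le_norm. Qed.

Lemma le_norm_ge0 x y : modulus x <= y -> `|x| <= `|y|.
Proof.
move=> xy; apply: le_norm_modulus; rewrite (le_trans xy)//.
exact: ler_modulus.
Qed.

Lemma norm_modulus x : `|modulus x| = `|x|.
Proof. by apply/le_anti/andP; split; apply: le_norm_modulus; rewrite modulusK. Qed.

Lemma modulus_join x y : modulus (Order.join x y) <= modulus x + modulus y.
Proof.
rewrite modulus_leP; apply/andP; split.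
  rewrite leUx; apply/andP; split.
    by rewrite -[x]addr0 blat_leD ?addr0 ?ler_modulus ?modulus_ge0.
  by rewrite -[y]add0r blat_leD ?add0r ?ler_modulus ?modulus_ge0.
apply: (@le_trans _ _ (- x)); first by rewrite blat_leN2 leUl.
by rewrite -[- x]addr0 blat_leD ?lerN_modulus ?modulus_ge0.
Qed.

(** Moving $y\vee z$ to the right leaves $x\vee z\le|x-y|+y\vee z$, checked on $x$ and $z$
    separately; the other sign follows by exchanging $x$ and $y$. *)
Lemma modulus_joinB x y z : modulus (Order.join x z - Order.join y z) <= modulus (x - y).
Proof.
have h (u v : X) : Order.join u z - Order.join v z <= modulus (u - v).
  rewrite blat_leBlDr leUx; apply/andP; split.
    rewrite -[u in u <= _](subrK v) blat_leD ?ler_modulus ?leUl//.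
  by rewrite -[z in z <= _]add0r blat_leD ?modulus_ge0 ?leUr.
by rewrite modulus_leP h opprB -(modulusN (x - y)) opprB h.
Qed.

Lemma modulus_modulusB x y : modulus (modulus x - modulus y) <= modulus (x - y).
Proof.
have h (u v : X) : modulus u - modulus v <= modulus (u - v).
  by rewrite blat_leBlDr -{1}[u](subrK v) modulusD.
by rewrite modulus_leP h opprB -(modulusN (x - y)) opprB h.
Qed.

Lemma norm_joinB x y z : `|Order.join x z - Order.join y z| <= `|x - y|.
Proof. exact/le_norm_modulus/modulus_joinB. Qed.

Lemma sup_modulus_leP n (x : 'I_n -> X) y :
  reflect (0 <= y /\ forall k, modulus (x k) <= y) (sup_modulus x <= y).
Proof.
apply: (iffP idP); rewrite /sup_modulus.
  elim: n x => [|n IH] x; first by rewrite big_ord0; split=> // -[].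
  rewrite big_ord_recl leUx => /andP[x0 /IH[y0 xS]]; split=> // k.
  by case: (unliftP ord0 k) => [j|] ->.
by case=> y0 h; elim/big_ind: _ => // u v uy vy; rewrite leUx uy vy.
Qed.

Lemma sup_modulus_ge0 n (x : 'I_n -> X) : 0 <= sup_modulus x.
Proof. by have /sup_modulus_leP[] := lexx (sup_modulus x). Qed.

Lemma modulus_le_sup n (x : 'I_n -> X) k : modulus (x k) <= sup_modulus x.
Proof. by have /sup_modulus_leP[] := lexx (sup_modulus x). Qed.

End VectorLattice.

(** * Closed convex solid sets and their gauges *)

Definition closed_convex_solid (R : realType) (X : banachLatticeType R)
    (A : set X) : Prop :=
  [/\ closed A,
      forall (t : R) x y, 0 <= t -> t <= 1 -> A x -> A y ->
        A (t *: x + (1 - t) *: y) &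
      forall x y, modulus x <= modulus y -> A y -> A x].

(** The data under which the gauge is a complete lattice norm on the span: boundedness makes it
    definite, solidity makes it monotone in the modulus, and closedness enters its completeness. *)
Record solid_ball (R : realType) (X : banachLatticeType R) := SolidBall {
  ball_set :> X -> Prop;
  ball_radius : R;
  ball_set0 : ball_set 0;
  ball_closed_convex_solid : closed_convex_solid ball_set;
  ball_bounded : forall x, ball_set x -> `|x| <= ball_radius
}.

Section Gauge.
Context {R : realType} {X : banachLatticeType R} (B : solid_ball X).
Implicit Types (x y : X) (a c d : R).

Lemma ball_closed : closed B.
Proof. by have [] := ball_closed_convex_solid B. Qed.

Lemma ball_convex (t : R) x y :
  0 <= t -> t <= 1 -> B x -> B y -> B (t *: x + (1 - t) *: y).
Proof. by have [_ + _] := ball_closed_convex_solid B; apply. Qed.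

Lemma ball_solid x y : modulus x <= modulus y -> B y -> B x.
Proof. by have [_ _] := ball_closed_convex_solid B; apply. Qed.

Definition gauge_dom : {pred X} :=
  [pred y | `[< exists c : R, 0 < c /\ B (c^-1 *: y) >]].

(** The Minkowski functional of [B]. Outside [gauge_dom] it takes the default value 0 of an empty
    infimum, hence the membership hypotheses below. *)
Definition gauge y : R := inf [set c : R | 0 < c /\ B (c^-1 *: y)].

Lemma gauge_domP y :
  reflect (exists c : R, 0 < c /\ B (c^-1 *: y)) (y \in gauge_dom).
Proof. exact: asboolP. Qed.

Lemma ball_scale c d y : 0 < c -> c <= d -> B (c^-1 *: y) -> B (d^-1 *: y).
Proof.
move=> c0 cd; have d0 := lt_le_trans c0 cd; apply: ball_solid.
rewrite !modulusZ !gtr0_norm ?invr_gt0//.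
rewrite -blat_subr_ge0 -scalerBl blat_scale_ge0 ?modulus_ge0//.
by rewrite subr_ge0 lef_pV2.
Qed.

(** The vector $(x+y)/(c+d)$ is the convex combination of $x/c$ and $y/d$ with weights $c/(c+d)$ and
    $d/(c+d)$. *)
Lemma ball_add c d x y : 0 < c -> 0 < d ->
  B (c^-1 *: x) -> B (d^-1 *: y) -> B ((c + d)^-1 *: (x + y)).
Proof.
move=> c0 d0 Bx By; have cd0 : 0 < c + d by rewrite addr_gt0.
have := @ball_convex (c / (c + d)) _ _ _ _ Bx By.
have -> : 1 - c / (c + d) = d / (c + d).
  by apply/eqP; rewrite subr_eq -mulrDl addrC divff// gt_eqF.
rewrite !scalerA ![_ / (c + d)]mulrC -!mulrA !mulfV ?gt_eqF// !mulr1.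
rewrite scalerDr; apply; first by rewrite mulr_ge0 ?invr_ge0 ?ltW.
by rewrite mulrC ler_pdivrMr// mul1r lerDl ltW.
Qed.

Lemma gauge_ge0 y : 0 <= gauge y.
Proof.
have [[c h]|h] := pselect (exists c, 0 < c /\ B (c^-1 *: y)).
  by apply: lb_le_inf => [|d [/ltW]//]; exists c.
rewrite /gauge (_ : [set c | _] = set0) ?inf0//.
by apply/seteqP; split => // c hc; case: h; exists c.
Qed.

Lemma gauge_le c y : 0 < c -> B (c^-1 *: y) -> gauge y <= c.
Proof.
move=> c0 Bc; apply: ge_inf; last by split.
by exists 0 => d [/ltW].
Qed.

Lemma gauge_lt_ball c y : y \in gauge_dom -> gauge y < c -> B (c^-1 *: y).
Proof.
move=> /gauge_domP yd yc; have [||d [d0 Bd] dc] := @inf_adherent _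
  [set c : R | 0 < c /\ B (c^-1 *: y)] (c - gauge y).
- by rewrite subr_gt0.
- by split=> //; exists 0 => d [/ltW].
rewrite -/(gauge y) addrC subrK in dc.
exact: ball_scale d0 (ltW dc) Bd.
Qed.

(** The case of equality rests on closedness: $d^{-1}y\in B$ for every $d>c$, and $d$ decreases to
    $c$. *)
Lemma gauge_le_ball c y : y \in gauge_dom -> 0 < c -> gauge y <= c ->
  B (c^-1 *: y).
Proof.
move=> yd c0 yc.
apply: (@closed_cvg _ _ (c^'+) _ (fun d => d^-1 *: y) B ball_closed).
  by near=> d; apply: gauge_lt_ball => //; apply: le_lt_trans yc _.
apply: cvgZr_tmp; apply: cvg_at_right_filter.
by apply: cvgV; [rewrite gt_eqF|exact: cvg_id].
Unshelve. all: by end_near. Qed.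

Lemma norm_le_gauge y : y \in gauge_dom -> `|y| <= ball_radius B * gauge y.
Proof.
move=> yd; have r0 : 0 <= ball_radius B.
  by rewrite -(normr0 X) ball_bounded//; exact: ball_set0.
have h c : gauge y < c -> `|y| <= ball_radius B * c.
  move=> yc; have c0 := le_lt_trans (gauge_ge0 y) yc.
  have /ball_bounded := gauge_lt_ball yd yc.
  by rewrite normrZ gtr0_norm ?invr_gt0// ler_pdivrMl// mulrC.
apply/ler_addgt0Pr => e e0; have r1 : 0 < ball_radius B + 1.
  by rewrite ltr_wpDl.
apply: le_trans (h (gauge y + e / (ball_radius B + 1)) _) _.
  by rewrite ltrDl divr_gt0.
rewrite mulrDr lerD2l mulrCA ler_piMr ?(ltW e0)//.
by rewrite ler_pdivrMr// mul1r lerDl.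
Qed.

Lemma gauge_dom_solid x y :
  modulus x <= modulus y -> y \in gauge_dom -> x \in gauge_dom.
Proof.
move=> xy /gauge_domP[c [c0 By]]; apply/gauge_domP; exists c; split=> //.
apply: ball_solid By; rewrite !modulusZ blat_leZ2l//.
Qed.

Lemma gauge_solid x y : modulus x <= modulus y -> y \in gauge_dom ->
  gauge x <= gauge y.
Proof.
move=> xy yd; apply/ler_addgt0Pr => e e0; apply: gauge_le.
  by rewrite ltr_wpDl ?gauge_ge0.
apply: (@ball_solid _ ((gauge y + e)^-1 *: y)).
  by rewrite !modulusZ blat_leZ2l.
by apply: gauge_lt_ball => //; rewrite ltrDl.
Qed.

Lemma gauge_domZ a y : y \in gauge_dom -> a *: y \in gauge_dom.
Proof.
(* Here $|a|+1$ keeps the scale positive when [a] vanishes. *)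
move=> /gauge_domP[c [c0 By]]; apply/gauge_domP; exists (c * (`|a| + 1)).
have a1 : 0 < `|a| + 1 by rewrite ltr_wpDl.
split; first by rewrite mulr_gt0.
apply: ball_solid By; rewrite scalerA !modulusZ normrM !normfV.
rewrite -blat_subr_ge0 -scalerBl blat_scale_ge0 ?modulus_ge0//.
rewrite subr_ge0 normrM invfM -mulrA ler_piMr// (gtr0_norm a1).
by rewrite ler_pdivrMl// mulr1 lerDl.
Qed.

Lemma gauge_domD x y : x \in gauge_dom -> y \in gauge_dom ->
  x + y \in gauge_dom.
Proof.
move=> /gauge_domP[c [c0 Bx]] /gauge_domP[d [d0 By]].
by apply/gauge_domP; exists (c + d); split; [rewrite addr_gt0|exact: ball_add].
Qed.

(** Since $|x\vee y|\le|x|+|y|$, solidity reduces joins to sums. *)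
Lemma gauge_dom_join x y : x \in gauge_dom -> y \in gauge_dom ->
  Order.join x y \in gauge_dom.
Proof.
move=> xd yd; apply: (@gauge_dom_solid _ (modulus x + modulus y)).
  by rewrite (le_trans (modulus_join x y))// ler_modulus.
by apply: gauge_domD; [move: xd|move: yd]; apply: gauge_dom_solid;
  rewrite modulusK.
Qed.

Lemma gaugeD x y : x \in gauge_dom -> y \in gauge_dom ->
  gauge (x + y) <= gauge x + gauge y.
Proof.
move=> xd yd; apply/ler_addgt0Pr => e e0.
have e20 : 0 < e / 2 by rewrite divr_gt0.
have hx : 0 < gauge x + e / 2 by rewrite ltr_wpDl ?gauge_ge0.
have hy : 0 < gauge y + e / 2 by rewrite ltr_wpDl ?gauge_ge0.
rewrite [e]splitr addrACA; apply: gauge_le; first by rewrite addr_gt0.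
by apply: ball_add => //; apply: gauge_lt_ball; rewrite ?ltrDl.
Qed.

Lemma gauge0 : gauge 0 = 0.
Proof.
apply/le_anti; rewrite gauge_ge0 andbT; apply/ler_addgt0Pr => e e0.
rewrite add0r; by apply: gauge_le => //; rewrite scaler0; exact: ball_set0.
Qed.

Lemma gaugeZ a y : y \in gauge_dom -> gauge (a *: y) = `|a| * gauge y.
Proof.
have h b z : z \in gauge_dom -> gauge (b *: z) <= `|b| * gauge z.
  move=> zd; have [->|b0] := eqVneq b 0; first by rewrite scale0r gauge0 normr0 mul0r.
  have nb0 : 0 < `|b| by rewrite normr_gt0.
  rewrite -ler_pdivrMl//; apply/ler_addgt0Pr => e e0.
  have : gauge z < gauge z + e by rewrite ltrDl.
  set c := gauge z + e => zc.
  have c0 := le_lt_trans (gauge_ge0 z) zc.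
  rewrite ler_pdivrMl//; apply: gauge_le; first by rewrite mulr_gt0.
  apply: ball_solid (gauge_lt_ball zd zc).
  rewrite scalerA !modulusZ normrM !normfV normrM normr_id invfM mulrAC.
  by rewrite mulVf ?gt_eqF// mul1r.
move=> yd; apply/le_anti; rewrite h//=.
have [->|a0] := eqVneq a 0; first by rewrite normr0 mul0r gauge_ge0.
(* For the reverse inequality, [h] is applied to $a^{-1}$ and $ay$. *)
rewrite -ler_pdivlMl ?normr_gt0// -normfV -{1}[y](scale1r) -(mulVf a0) -scalerA.
by rewrite h// gauge_domZ.
Qed.

Lemma gauge_eq0 y : y \in gauge_dom -> gauge y = 0 -> y = 0.
Proof.
move=> yd y0; apply/eqP; rewrite -normr_le0.
by rewrite (le_trans (norm_le_gauge yd))// y0 mulr0.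
Qed.

Lemma gauge_dom_submod : submod_closed gauge_dom.
Proof.
split; last by move=> a x y xd yd; rewrite gauge_domD ?gauge_domZ.
by apply/gauge_domP; exists 1; rewrite scaler0; split=> //; exact: ball_set0.
Qed.

HB.instance Definition _ := GRing.isSubmodClosed.Build R X gauge_dom
  gauge_dom_submod.

End Gauge.

(** * The span of a solid ball as a Banach lattice under the gauge *)

Section GaugeSpace.
Context {R : realType} {X : banachLatticeType R} (B : solid_ball X).

Record gauge_space := GaugeSpace {
  gauge_val : X;
  gauge_valP : gauge_val \in gauge_dom B
}.

HB.instance Definition _ := [isSub for gauge_val].
HB.instance Definition _ := [Choice of gauge_space by <:].
HB.instance Definition _ := [SubChoice_isSubLmodule of gauge_space by <:].

Implicit Types u v w : gauge_space.

Let gauge_normD u v :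
  gauge B (gauge_val (u + v)) <= gauge B (gauge_val u) + gauge B (gauge_val v).
Proof. by apply: gaugeD; apply: gauge_valP. Qed.

Let gauge_normZ (a : R) u :
  gauge B (gauge_val (a *: u)) = `|a| * gauge B (gauge_val u).
Proof. by apply: gaugeZ; apply: gauge_valP. Qed.

Let gauge_norm_eq0 u : gauge B (gauge_val u) = 0 -> u = 0.
Proof. by move=> u0; apply/val_inj/(@gauge_eq0 _ _ B) => //; apply: gauge_valP. Qed.

HB.instance Definition _ := Lmodule_isNormed.Build R gauge_space
  gauge_normD gauge_normZ gauge_norm_eq0.

Lemma gauge_normE u : `|u| = gauge B (gauge_val u).
Proof. by []. Qed.

(** A gauge-Cauchy filter is norm-Cauchy, since the radius times the gauge dominates the norm, and
    so has a limit [l] in [X]. It remains to see that [l] lies in the span and is a limit for the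
    gauge. *)
Lemma gauge_space_complete (F : set_system gauge_space) :
  ProperFilter F -> cauchy F -> cvg F.
Proof.
move=> FF /cauchy_ballP Fc.
have r0 : 0 <= ball_radius B.
  by rewrite -(normr0 X) ball_bounded//; exact: ball_set0.
have : cauchy (gauge_val @ F).
  apply/cauchy_ballP => e e0; near_simpl.
  have d0 : 0 < e / (ball_radius B + 1) by rewrite divr_gt0// ltr_wpDl.
  apply: filterS (Fc _ d0) => -[u v] /=; rewrite -!ball_normE/= => uv.
  have := norm_le_gauge (gauge_valP (u - v)).
  move=> /le_lt_trans; apply; rewrite -gauge_normE.
  apply: (@le_lt_trans _ _ ((ball_radius B + 1) * `|u - v|)).
    by rewrite ler_wpM2r// lerDl.
  by rewrite mulrC -ltr_pdivlMr// ltr_wpDl.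
move=> /cauchy_cvg; move: (lim _) => l Fl.
(* On a small rectangle of the Cauchy filter $u-v\in eB$; as [B] is closed, letting $v$ tend to [l]
   gives $u-l\in eB$. *)
have near_l (e : R) : 0 < e ->
    \forall u \near F, B (e^-1 *: (gauge_val u - l)).
  move=> e0; have [/= [P Q] [FP FQ] PQ] := Fc e e0.
  apply: filterS FP => u Pu.
  apply: (@closed_cvg _ _ F _ (fun v => e^-1 *: (gauge_val u - gauge_val v)) B
    (ball_closed (B := B))).
    apply: filterS FQ => v Qv.
    have /= := PQ (u, v) (conj Pu Qv); rewrite -ball_normE/= gauge_normE => uv.
    by apply: (gauge_lt_ball (gauge_valP (u - v))).
  by apply: cvgZr; apply: cvgB; [exact: cvg_cst|exact: Fl].
(* The case $e=1$ gives some [u] with $u-l\in B$, whence $l=u-(u-l)$ is in the span. *)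
have /filter_ex[u Bu] := near_l 1 ltr01.
have ld : l \in gauge_dom B.
  rewrite -(subKr (gauge_val u) l) rpredB ?gauge_valP//.
  by apply/gauge_domP; exists 1.
apply/cvg_ex; exists (GaugeSpace ld); apply/cvgrPdist_le => e e0.
apply: filterS (near_l e e0) => v Bv.
by rewrite distrC gauge_normE; apply: gauge_le.
Qed.

HB.instance Definition _ :=
  Uniform_isComplete.Build gauge_space gauge_space_complete.

Let gauge_le_space u v := gauge_val u <= gauge_val v.

Definition gauge_join u v : gauge_space :=
  GaugeSpace (gauge_dom_join (gauge_valP u) (gauge_valP v)).

Definition gauge_meet u v : gauge_space := - gauge_join (- u) (- v).

Let gauge_meetE u v :
  gauge_val (gauge_meet u v) = Order.meet (gauge_val u) (gauge_val v).
Proof. by rewrite meet_oppr_join. Qed.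

Let gauge_le_refl : reflexive gauge_le_space.
Proof. by move=> u; exact: lexx. Qed.

Let gauge_le_anti : antisymmetric gauge_le_space.
Proof. by move=> u v uv; apply/val_inj/le_anti. Qed.

Let gauge_le_trans : transitive gauge_le_space.
Proof. by move=> v u w; exact: le_trans. Qed.

Let gauge_meetP u v w :
  gauge_le_space u (gauge_meet v w) = gauge_le_space u v && gauge_le_space u w.
Proof. by rewrite /gauge_le_space gauge_meetE lexI. Qed.

Let gauge_joinP u v w :
  gauge_le_space (gauge_join u v) w = gauge_le_space u w && gauge_le_space v w.
Proof. exact: leUx. Qed.

Let gauge_leD2r u v w : gauge_le_space u v -> gauge_le_space (u + w) (v + w).
Proof. exact: bl_leD2r. Qed.

Let gauge_leZ2l (a : R) u v :
  0 <= a -> gauge_le_space u v -> gauge_le_space (a *: u) (a *: v).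
Proof. exact: bl_leZ2l. Qed.

Let gauge_le_norm u v :
  gauge_le_space (gauge_join u (- u)) (gauge_join v (- v)) -> `|u| <= `|v|.
Proof. by move=> uv; apply: gauge_solid => //; apply: gauge_valP. Qed.

HB.instance Definition _ := isBanachLattice.Build R gauge_space
  gauge_le_refl gauge_le_anti gauge_le_trans gauge_meetP gauge_joinP
  gauge_leD2r gauge_leZ2l gauge_le_norm.

Definition gauge_lattice : banachLatticeType R := gauge_space.

Definition gauge_incl (u : gauge_lattice) : X := gauge_val u.

Let gauge_incl_is_linear : linear gauge_incl.
Proof. by []. Qed.

HB.instance Definition _ :=
  GRing.isLinear.Build R gauge_lattice X *:%R gauge_incl gauge_incl_is_linear.

Lemma gauge_incl_lattice_hom : lattice_hom gauge_incl.
Proof. by split=> u v //; exact: gauge_meetE. Qed.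

Lemma norm_gauge_incl u : `|gauge_incl u| <= ball_radius B * `|u|.
Proof. exact/norm_le_gauge/gauge_valP. Qed.

End GaugeSpace.

(** * Closed convex solid hulls and weighted joins *)

Lemma lipschitz_continuous (R : realType) (E F : normedModType R) (f : E -> F)
    (k : R) : (forall x y, `|f x - f y| <= k * `|x - y|) -> continuous f.
Proof.
move=> fk x; apply/(@cvgrPdist_le _ _ _ (nbhs x)) => e e0.
have k1 : 0 < `|k| + 1 by rewrite ltr_wpDl.
near=> y; apply: le_trans (fk x y) _.
apply: (@le_trans _ _ ((`|k| + 1) * `|x - y|)).
  by rewrite ler_wpM2r// (le_trans (ler_norm k))// lerDl.
rewrite -ler_pdivlMl//; near: y.
by apply: cvgr_dist_le; [exact: cvg_id|rewrite mulr_gt0 ?invr_gt0].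
Unshelve. all: by end_near. Qed.

Section JoinStability.
Context {R : realType} {X : banachLatticeType R}.
Implicit Types (A : set X) (x y z w : X).

(** Applied to all closed convex solid sets containing a given one, this makes [smallest] itself
    closed, convex and solid. *)
Lemma closed_convex_solid_bigcap (I : Type) (D : set I) (F : I -> set X) :
  (forall i, D i -> closed_convex_solid (F i)) ->
  closed_convex_solid (\bigcap_(i in D) F i).
Proof.
move=> DF; split.
- by apply: closed_bigI => i /DF[].
- by move=> t x y t0 t1 Ax Ay i Di; have [_ + _] := DF i Di; apply=> //;
    [exact: Ax | exact: Ay].
- by move=> x y xy Ay i Di; have [_ _] := DF i Di; apply; [exact: xy|exact: Ay].
Qed.

Lemma closed_convex_solid_norm (K : R) :
  closed_convex_solid [set x : X | `|x| <= K].
Proof.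
split.
- by apply: (@preimage_closed _ _ (fun x : X => `|x|) [set r | r <= K]);
    [move=> x _; exact: (@norm_continuous _ X) | exact: closed_le].
- move=> t x y t0 t1 /= xK yK; apply: (le_trans (ler_normD _ _)).
  rewrite !normrZ (ger0_norm t0) ger0_norm ?subr_ge0//.
  have -> : K = t * K + (1 - t) * K by rewrite -mulrDl subrKC mul1r.
  by rewrite lerD// ler_wpM2l// subr_ge0.
- by move=> x y /le_norm_modulus; exact: le_trans.
Qed.

(* [y |-> a |y| \/ w] is a convex monotone function of |y|, so that preimages
   of convex solid sets are again convex and solid. *)
Lemma closed_convex_solid_join A (a : R) w : 0 <= a -> 0 <= w ->
  closed_convex_solid A ->
  closed_convex_solid [set y | A (Order.join (a *: modulus y) w)].
Proof.
move=> a0 w0 [Acl Acv Aso]; split.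
- apply: (@preimage_closed _ _ (fun y => Order.join (a *: modulus y) w) A) => // y _.
  apply: (@lipschitz_continuous _ _ _ _ a) => u v.
  apply: le_trans (norm_joinB _ _ _) _.
  rewrite -scalerBr normrZ ger0_norm// ler_wpM2l//.
  exact/le_norm_modulus/modulus_modulusB.
- move=> t x y t0 t1 /= Ax Ay; apply: Aso (Acv t _ _ t0 t1 Ax Ay).
  have s0 : 0 <= 1 - t by rewrite subr_ge0.
  apply: le_modulus; first by rewrite (le_trans w0)// leUr.
  rewrite leUx; apply/andP; split.
    apply: (@le_trans _ _ (a *: (t *: modulus x + (1 - t) *: modulus y))).
      rewrite blat_leZ2l// (le_trans (modulusD _ _))// !modulusZ.
      by rewrite (ger0_norm t0) (ger0_norm s0).
    rewrite scalerDr !scalerA ![a * _]mulrC -!scalerA.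
    by rewrite blat_leD// blat_leZ2l// leUl.
  have {1}-> : w = t *: w + (1 - t) *: w by rewrite -scalerDl subrKC scale1r.
  by rewrite blat_leD// blat_leZ2l// leUr.
- move=> x y xy /=; apply: Aso.
  apply: le_modulus; first by rewrite (le_trans w0)// leUr.
  by rewrite leUx leUr andbT (le_trans _ (leUl _ _))// blat_leZ2l.
Qed.

Lemma smallest_join_closed (G : set X) (a b : R) : 0 <= a -> 0 <= b ->
  (forall x y, G x -> G y -> G (Order.join (a *: modulus x) (b *: modulus y))) ->
  forall x y, smallest (@closed_convex_solid R X) G x ->
    smallest (@closed_convex_solid R X) G y ->
  smallest (@closed_convex_solid R X) G
    (Order.join (a *: modulus x) (b *: modulus y)).
Proof.
move=> a0 b0 Gab; set C := smallest _ _.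
have Cccs : closed_convex_solid C.
  by apply: closed_convex_solid_bigcap => A [].
have GC : G `<=` C by exact: sub_gen_smallest.
(* With [y] fixed in [G], the admissible [x] form a closed convex solid set containing [G], hence
   containing [C]. *)
have step y : G y -> C `<=` [set x | C (Order.join (a *: modulus x) (b *: modulus y))].
  move=> Gy; apply: smallest_sub.
    by apply: closed_convex_solid_join => //; rewrite blat_scale_ge0 ?modulus_ge0.
  by move=> x Gx; apply: GC; exact: Gab.
(* Now [x] is fixed in [C], and the previous step handles the generators [y]; the join is commuted
   so that the varying vector stands first. *)
move=> x y Cx; suff : C `<=` [set y | C (Order.join (b *: modulus y) (a *: modulus x))].
  by move=> + Cy => /(_ _ Cy); rewrite /= joinC.
apply: smallest_sub.
  by apply: closed_convex_solid_join => //; rewrite blat_scale_ge0 ?modulus_ge0.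
by move=> z Gz /=; rewrite joinC; exact: step.
Qed.

End JoinStability.

(** * Upper $p$-estimates from join-stable balls *)

Section UpperEstimate.
Context {R : realType} (p : R) (hp : 1 < p).

Let p_gt0 : 0 < p. Proof. exact: lt_trans hp. Qed.
Let p_neq0 : p != 0. Proof. by rewrite gt_eqF. Qed.

Lemma powRK (a : R) : 0 <= a -> (a `^ p) `^ p^-1 = a.
Proof. by move=> a0; rewrite -powRrM mulfV// powRr1. Qed.

Lemma powRVK (a : R) : 0 <= a -> (a `^ p^-1) `^ p = a.
Proof. by move=> a0; rewrite -powRrM mulVf// powRr1. Qed.

Lemma le_powRV (a b : R) : 0 <= a -> 0 <= b -> (a <= b `^ p^-1) = (a `^ p <= b).
Proof.
move=> a0 b0; apply/idP/idP => h.
  by rewrite -[b]powRVK// ge0_ler_powR ?nnegrE ?powR_ge0// ltW.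
by rewrite -[a]powRK// ge0_ler_powR ?nnegrE ?powR_ge0// invr_ge0 ltW.
Qed.

(** The two-vector inequality has constant 1, so it iterates without loss: a supremum of moduli
    equals its own modulus and can serve as one of the two vectors. *)
Lemma upper_p_estimate_join (Y : banachLatticeType R) :
  (forall x y : Y,
    `|Order.join (modulus x) (modulus y)| `^ p <= `|x| `^ p + `|y| `^ p) ->
  upper_p_estimate_with p Y 1.
Proof.
move=> hY n y; rewrite mul1r /lp_sum le_powRV ?sumr_ge0//.
elim: n y => [|n IH] y.
  by rewrite /sup_modulus !big_ord0 normr0 powR0.
rewrite [leRHS]big_ord_recl /=.
have -> : sup_modulus y =
    Order.join (modulus (y ord0)) (modulus (sup_modulus (fun i => y (lift ord0 i)))).
  by rewrite (modulus_id (sup_modulus_ge0 _)) /sup_modulus big_ord_recl.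
by apply: le_trans (hY _ _) _; rewrite lerD2l IH.
Qed.

Section JoinStableBall.
Context {X : banachLatticeType R} (B : solid_ball X).
Hypothesis ball_join : forall (a b : R) x y, 0 <= a -> 0 <= b ->
  a `^ p + b `^ p <= 1 -> B x -> B y ->
  B (Order.join (a *: modulus x) (b *: modulus y)).

(** Write $g$ for the gauge and $c=(g(x)^p+g(y)^p)^{1/p}$. Then $c^{-1}(|x|\vee|y|)$ is the join of
    the moduli of the normalised vectors with weights $g(x)/c$ and $g(y)/c$, whose $p$-th powers add
    up to one. *)
Lemma gauge_join_le x y : x \in gauge_dom B -> y \in gauge_dom B ->
  gauge B (Order.join (modulus x) (modulus y)) `^ p
    <= gauge B x `^ p + gauge B y `^ p.
Proof.
move=> xd yd.
have gauge_modulus z : z \in gauge_dom B -> gauge B (modulus z) <= gauge B z.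
  by apply: gauge_solid; rewrite modulusK.
have pR_le (a b : R) : 0 <= a -> a <= b -> a `^ p <= b `^ p.
  by move=> a0 ab; rewrite ge0_ler_powR ?nnegrE ?(ltW p_gt0)// (le_trans a0).
(* Normalisation divides by the gauges, so vanishing ones are treated first; they force the vector
   to be zero. *)
have [x0|x0] := eqVneq (gauge B x) 0.
  rewrite (gauge_eq0 xd x0) modulus0 join_r ?modulus_ge0//.
  by rewrite gauge0 powR0// add0r pR_le ?gauge_ge0 ?gauge_modulus.
have [y0|y0] := eqVneq (gauge B y) 0.
  rewrite (gauge_eq0 yd y0) modulus0 join_l ?modulus_ge0//.
  by rewrite gauge0 powR0// addr0 pR_le ?gauge_ge0 ?gauge_modulus.
have gx : 0 < gauge B x by rewrite lt_neqAle eq_sym x0 gauge_ge0.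
have gy : 0 < gauge B y by rewrite lt_neqAle eq_sym y0 gauge_ge0.
set s := _ + _; have s0 : 0 < s by rewrite addr_gt0 ?powR_gt0.
rewrite -le_powRV ?gauge_ge0 ?(ltW s0)//.
set c := s `^ p^-1; have c0 : 0 < c by rewrite powR_gt0.
apply: gauge_le => //.
have -> : c^-1 *: Order.join (modulus x) (modulus y) =
    Order.join ((gauge B x / c) *: modulus ((gauge B x)^-1 *: x))
               ((gauge B y / c) *: modulus ((gauge B y)^-1 *: y)).
  rewrite joinZ ?invr_ge0 ?(ltW c0)// !modulusZ !scalerA.
  by rewrite !gtr0_norm ?invr_gt0// ![_ / c]mulrC !mulfK.
apply: ball_join.
- by rewrite divr_ge0 ?gauge_ge0 ?ltW.
- by rewrite divr_ge0 ?gauge_ge0 ?ltW.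
- rewrite !powRM ?gauge_ge0 ?invr_ge0 ?(ltW c0)// -mulrDl -/s.
  by rewrite -powR_inv1 ?(ltW c0)// powRAC powRVK ?(ltW s0)//
    powR_inv1 ?(ltW s0)// mulfV// gt_eqF.
- exact: gauge_le_ball.
- exact: gauge_le_ball.
Qed.

Lemma gauge_lattice_upper_p_estimate : upper_p_estimate_with p (gauge_lattice B) 1.
Proof.
apply: upper_p_estimate_join => u v.
by apply: gauge_join_le; exact: gauge_valP.
Qed.

End JoinStableBall.

(** * Factorization of a $(p,\infty)$-convex operator *)

Section ConvexFactorization.
Context {E : completeNormedModType R} {X : banachLatticeType R}.
Context (T : {linear E -> X}) (K : R) (K_ge0 : 0 <= K).
Hypothesis TK : pinf_convex_with p T K.

Definition dominated_by_image : set X :=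
  [set w | exists n (x : 'I_n -> E),
    \sum_(k < n) `|x k| `^ p <= 1 /\
    modulus w <= sup_modulus (fun k => T (x k))].

(** The scaled families $(ax_i)$ and $(by_j)$ are concatenated: the $p$-th powers of their norms sum
    to at most $a^p+b^p\le1$, and the common supremum dominates both terms of the join. *)
Lemma dominated_by_image_join (a b : R) v w : 0 <= a -> 0 <= b ->
  a `^ p + b `^ p <= 1 -> dominated_by_image v -> dominated_by_image w ->
  dominated_by_image (Order.join (a *: modulus v) (b *: modulus w)).
Proof.
move=> a0 b0 ab1 [n [x [x1 vx]]] [m [y [y1 wy]]].
pose z (k : 'I_(n + m)) :=
  match fintype.split k with inl i => a *: x i | inr j => b *: y j end.
have zl i : z (lshift m i) = a *: x i by rewrite /z (unsplitK (inl i)).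
have zr j : z (rshift n j) = b *: y j by rewrite /z (unsplitK (inr j)).
exists (n + m)%N, z; split.
  rewrite big_split_ord/=.
  under eq_bigr do rewrite zl normrZ powRM// (ger0_norm a0).
  under [X in _ + X]eq_bigr do rewrite zr normrZ powRM// (ger0_norm b0).
  rewrite -!mulr_sumr; apply: le_trans ab1.
  by rewrite lerD// ler_piMr// powR_ge0.
have h (c : R) k (u : 'I_k -> E) (f : 'I_k -> 'I_(n + m)) t : 0 <= c ->
    modulus t <= sup_modulus (fun i => T (u i)) ->
    (forall i, z (f i) = c *: u i) ->
    c *: modulus t <= sup_modulus (fun i => T (z i)).
  move=> c0 tu zf; apply: (@le_trans _ _ (c *: sup_modulus (fun i => T (u i)))).
    exact: blat_leZ2l.
  have [->|cn0] := eqVneq c 0; first by rewrite scale0r sup_modulus_ge0.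
  have cp : 0 < c by rewrite lt_neqAle eq_sym cn0.
  rewrite -(@blat_leZ2l_pos _ _ c^-1) ?invr_gt0// scalerA mulVf// scale1r.
  apply/sup_modulus_leP; split=> [|i].
    by rewrite blat_scale_ge0 ?sup_modulus_ge0// invr_ge0.
  rewrite -(@blat_leZ2l_pos _ _ c)// scalerA mulfV// scale1r.
  rewrite -{1}(ger0_norm c0) -modulusZ -linearZ -zf.
  exact: (modulus_le_sup (fun i => T (z i))).
rewrite modulus_id; last by rewrite (le_trans _ (leUl _ _))// blat_scale_ge0 ?modulus_ge0.
by rewrite leUx (h a n x (lshift m))// (h b m y (@rshift n m)).
Qed.

Let C := smallest (@closed_convex_solid R X) dominated_by_image.

Let C0 : C 0.
Proof.
apply: sub_gen_smallest; exists 0%N, (fun=> 0); rewrite big_ord0 ler01.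
by rewrite modulus0 sup_modulus_ge0.
Qed.

Let C_ccs : closed_convex_solid C.
Proof. by apply: closed_convex_solid_bigcap => A []. Qed.

(** The ball of radius [K] is closed, convex and solid, so it is enough to bound the generators; for
    these the bound is $(p,\infty)$-convexity. *)
Let C_bounded x : C x -> `|x| <= K.
Proof.
move: x; apply: smallest_sub; first exact: closed_convex_solid_norm.
move=> w [n [x [x1 wx]]] /=; apply: le_trans (le_norm_ge0 wx) _.
apply: le_trans (TK x) _; rewrite ler_piMr//.
rewrite -[leRHS](_ : 1 `^ p^-1 = 1) /lp_sum; last by rewrite powR1.
by rewrite ge0_ler_powR ?nnegrE ?invr_ge0 ?(ltW p_gt0) ?sumr_ge0.
Qed.

Definition image_ball : solid_ball X := SolidBall C0 C_ccs C_bounded.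

Lemma image_ball_join (a b : R) x y : 0 <= a -> 0 <= b ->
  a `^ p + b `^ p <= 1 -> image_ball x -> image_ball y ->
  image_ball (Order.join (a *: modulus x) (b *: modulus y)).
Proof.
move=> a0 b0 ab1; apply: smallest_join_closed => // v w.
exact: dominated_by_image_join.
Qed.

(** The one-vector family $c^{-1}x$ suffices. Allowing any positive $c\ge\|x\|$ covers $x=0$. *)
Lemma image_ball_image (x : E) (c : R) : 0 < c -> `|x| <= c ->
  image_ball (c^-1 *: T x).
Proof.
move=> c0 xc; apply: sub_gen_smallest; exists 1%N, (fun=> c^-1 *: x); split.
  rewrite big_ord1 -[leRHS](_ : 1 `^ p = 1); last by rewrite powR1.
  rewrite ge0_ler_powR ?nnegrE ?(ltW p_gt0)//.
  by rewrite normrZ gtr0_norm ?invr_gt0// ler_pdivrMl// mulr1.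
by rewrite -linearZ; apply: (modulus_le_sup (fun=> T (c^-1 *: x)) ord0).
Qed.

Lemma image_gauge_dom (x : E) : T x \in gauge_dom image_ball.
Proof.
apply/gauge_domP; exists (`|x| + 1); have x1 : 0 < `|x| + 1 by rewrite ltr_wpDl.
by split=> //; apply: image_ball_image; rewrite // lerDl.
Qed.

Definition corestriction (x : E) : gauge_lattice image_ball :=
  GaugeSpace (image_gauge_dom x).

Let corestriction_is_linear : linear corestriction.
Proof. by move=> a x y; apply: val_inj; rewrite /= linearP. Qed.

HB.instance Definition _ := GRing.isLinear.Build R E (gauge_lattice image_ball)
  *:%R corestriction corestriction_is_linear.

Lemma norm_corestriction x : `|corestriction x| <= `|x|.
Proof.
rewrite gauge_normE; apply/ler_addgt0Pr => e e0.
have x1 : 0 < `|x| + e by rewrite ltr_wpDl.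
by apply: gauge_le => //; apply: image_ball_image; rewrite // lerDl ltW.
Qed.

End ConvexFactorization.

(** The constants 1, 1 and [K] are kept explicit, since the norm estimate on the free lattice is
    read off from them. *)
Lemma pinf_convex_factorization (E : completeNormedModType R)
    (X : banachLatticeType R) (T : {linear E -> X}) (K : R) :
  0 <= K -> pinf_convex_with p T K ->
  exists (Y : banachLatticeType R) (phi : {linear E -> Y})
         (S : {linear Y -> X}),
    [/\ upper_p_estimate_with p Y 1, forall x, `|phi x| <= `|x|,
        lattice_hom S, forall y, `|S y| <= K * `|y| &
        forall x, T x = S (phi x)].
Proof.
move=> K0 TK; exists (gauge_lattice (image_ball K0 TK)).
exists (corestriction K0 TK), (@gauge_incl _ _ (image_ball K0 TK)); split=> //.
- apply: gauge_lattice_upper_p_estimate => a b x y a0 b0 ab1.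
  exact: image_ball_join.
- exact: norm_corestriction.
- exact: gauge_incl_lattice_hom.
- exact: norm_gauge_incl.
Qed.

End UpperEstimate.

(** * Lattice homomorphisms: automatic continuity and uniqueness *)

Section LatticeHom.
Context {R : realType}.

(** The positive cone is the zero set of the Lipschitz function $x\mapsto\||x|-x\|$. *)
Lemma closed_nonneg (X : banachLatticeType R) : closed [set x : X | 0 <= x].
Proof.
have -> : [set x : X | 0 <= x] = (fun x => `|modulus x - x|) @^-1` [set r | r <= 0].
  apply/seteqP; split=> x /=; first by move=> x0; rewrite modulus_id// subrr normr0.
  by rewrite normr_le0 subr_eq0 => /eqP <-; exact: modulus_ge0.
apply: preimage_closed; last exact: closed_le.
move=> x _; apply: (@lipschitz_continuous _ _ R _ 2) => u v.
rewrite (le_trans (ler_dist_dist _ _))// opprD addrACA -opprD.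
rewrite (le_trans (ler_normB _ _))// mulr_natl mulr2n lerD//.
exact/le_norm_modulus/modulus_modulusB.
Qed.

Section Hom.
Context {Y X : banachLatticeType R} (S : {linear Y -> X}) (hS : lattice_hom S).

Lemma lattice_hom_modulus y : S (modulus y) = modulus (S y).
Proof. by have [-> _] := hS; rewrite linearN. Qed.

Lemma lattice_hom_ge0 y : 0 <= y -> 0 <= S y.
Proof. by move=> /modulus_id <-; rewrite lattice_hom_modulus modulus_ge0. Qed.

Lemma lattice_hom_le x y : x <= y -> S x <= S y.
Proof.
by rewrite -blat_subr_ge0 => /lattice_hom_ge0; rewrite linearB blat_subr_ge0.
Qed.

Lemma lattice_hom_sup_modulus n (y : 'I_n -> Y) :
  S (sup_modulus y) = sup_modulus (fun k => S (y k)).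
Proof.
rewrite /sup_modulus (big_morph S (proj1 hS) (linear0 S)).
by under eq_bigr do rewrite lattice_hom_modulus.
Qed.

(* If |S y_n| > n 2^n |y_n|, then the sum of the |y_n| / (2^n |y_n|) would be
   mapped to an element of norm greater than every n. *)
Lemma lattice_hom_bounded : exists K : R, 0 <= K /\ forall y, `|S y| <= K * `|y|.
Proof.
suff [K hK] : exists K : R, forall y, `|S y| <= K * `|y|.
  exists (Num.max K 0); rewrite le_max lexx orbT; split=> // y.
  by rewrite (le_trans (hK y))// ler_wpM2r// le_max lexx.
apply: contrapT => unb.
have /choice[y hy] : forall n : nat, exists y, n%:R * 2 ^+ n * `|y| < `|S y|.
  move=> n; apply: contrapT => hn; apply: unb; exists (n%:R * 2 ^+ n) => y.
  by rewrite leNgt; apply/negP => lt_y; apply: hn; exists y.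
have y_gt0 n : 0 < `|y n|.
  rewrite normr_gt0; apply/eqP => y0; have := hy n.
  by rewrite y0 linear0 !normr0 mulr0 ltxx.
pose z n := (2 ^+ n * `|y n|)^-1 *: modulus (y n).
have z_norm n : `|z n| = 2^-1 ^+ n.
  rewrite normrZ norm_modulus gtr0_norm ?invr_gt0 ?mulr_gt0 ?exprn_gt0//.
  by rewrite invfM mulfVK ?gt_eqF// exprVn.
have z_ge0 n : 0 <= z n.
  by rewrite blat_scale_ge0 ?modulus_ge0// invr_ge0 mulr_ge0 ?exprn_ge0.
have Sz n : n%:R < `|S (z n)|.
  rewrite linearZ lattice_hom_modulus normrZ norm_modulus.
  rewrite gtr0_norm ?invr_gt0 ?mulr_gt0 ?exprn_gt0//.
  by rewrite ltr_pdivlMl ?mulr_gt0 ?exprn_gt0// mulrC mulrA.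
have /normed_cvg/cvg_ex[/= s zs] : cvgn [normed series z].
  apply: (@series_le_cvg _ _ (geometric 1 2^-1)) => //.
  - by move=> n /=.
  - by move=> n; rewrite /geometric/= mul1r exprn_ge0.
  - by move=> n; rewrite /geometric/= z_norm mul1r.
  - by apply: is_cvg_geometric_series; rewrite gtr0_norm// invf_lt1// ltr1n.
have zle n : z n <= s.
  rewrite -blat_subr_ge0.
  apply: (@closed_cvg _ _ \oo _ (fun m => series z m - z n) [set x : Y | 0 <= x]
    (@closed_nonneg Y)); last by apply: cvgB => //; exact: cvg_cst.
  (* The partial sum [series z m] runs over indices below [m], so it contains $z_n$ as soon as
     $m>n$; the remaining terms are nonnegative. *)
  exists n.+1 => // m /= nm.
  rewrite /series/= (bigD1_seq n) ?iota_uniq ?mem_index_iota//=.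
  rewrite addrAC subrr add0r.
  by elim/big_ind: _ => // u v u0 v0; rewrite -[0]addr0 blat_leD.
have Ss n : n%:R < `|S s|.
  apply: lt_le_trans (Sz n) _; apply: le_norm_ge0.
  by rewrite modulus_id ?lattice_hom_le ?lattice_hom_ge0.
have := Ss (Num.truncn `|S s|).+1.
by rewrite ltNge => /negP; apply; rewrite ltW// truncnS_gt.
Qed.

Lemma lattice_hom_continuous : continuous S.
Proof.
have [K [_ hK]] := lattice_hom_bounded.
by apply: (@lipschitz_continuous _ _ _ _ K) => x y; rewrite -linearB.
Qed.

End Hom.

(** Lattice homomorphisms are automatically continuous, so the equalizer [A] is a closed linear
    sublattice; containing [G], it contains the dense sublattice generated by [G]. *)
Lemma lattice_hom_eq_dense (Z X : banachLatticeType R) (G : set Z)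
    (S1 S2 : {linear Z -> X}) :
  lattice_hom S1 -> lattice_hom S2 -> dense (generated_sublattice G) ->
  (forall z, G z -> S1 z = S2 z) -> forall z, S1 z = S2 z.
Proof.
move=> h1 h2 dG eqG z.
pose A := [set z : Z | S1 z = S2 z].
have GA : generated_sublattice G `<=` A.
  apply: smallest_sub => //; split; rewrite /A /=.
  - by rewrite !linear0.
  - by move=> a x y xA yA; rewrite !linearP xA yA.
  - by move=> x y xA yA; rewrite (proj1 h1) (proj1 h2) xA yA.
  - by move=> x y xA yA; rewrite (proj2 h1) (proj2 h2) xA yA.
have clA : closed A.
  have -> : A = (fun z => `|S1 z - S2 z|) @^-1` [set r | r <= 0].
    apply/seteqP; split=> x; rewrite /A /= normr_le0 subr_eq0.
      by move=> ->.
    by move=> /eqP.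
  apply: preimage_closed; last exact: closed_le.
  move=> x _; apply: cvg_norm; apply: cvgB; exact: lattice_hom_continuous.
apply: contrapT => zA.
have [x [/= + /GA]] := dG (~` A) (ex_intro _ z zA) (closed_openC clA).
by [].
Qed.

End LatticeHom.

(** * Operator norm and convexity constant as attained infima *)

Section OperatorConstants.
Context {R : realType}.

Lemma bounded_op_nneg (E F : normedModType R) (T : E -> F) : bounded_op T ->
  exists K : R, 0 <= K /\ forall x, `|T x| <= K * `|x|.
Proof.
move=> [K hK]; exists (Num.max K 0); rewrite le_max lexx orbT; split=> // y.
by rewrite (le_trans (hK y))// ler_wpM2r// le_max lexx.
Qed.

Lemma opnorm_le (E F : normedModType R) (T : E -> F) (K : R) :
  0 <= K -> (forall x, `|T x| <= K * `|x|) -> opnorm T <= K.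
Proof. by move=> K0 TK; apply: ge_inf; [exists 0 => c []|split]. Qed.

(** The infimum is attained because every admissible constant is at least $\|Tx\|/\|x\|$ when
    $\|x\|>0$. *)
Lemma opnorm_bound (E F : normedModType R) (T : E -> F) x :
  bounded_op T -> `|T x| <= opnorm T * `|x|.
Proof.
move=> /bounded_op_nneg[K [K0 hK]]; have [x0|x0] := eqVneq `|x| 0.
  by have := hK x; rewrite x0 !mulr0.
have xp : 0 < `|x| by rewrite lt_neqAle eq_sym x0 normr_ge0.
rewrite -ler_pdivrMr//; apply: lb_le_inf; first by exists K.
by move=> c [c0 hc]; rewrite ler_pdivrMr.
Qed.

(** The argument is that for the operator norm, with [lp_sum] as divisor; later estimates can thus
    use the best constant itself. *)
Lemma pinf_constP (p : R) (E : completeNormedModType R)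
    (X : banachLatticeType R) (T : E -> X) : pinf_convex p T ->
  0 <= pinf_const p T /\ pinf_convex_with p T (pinf_const p T).
Proof.
move=> [K0 hK0].
have [K [K_ge0 hK]] : exists K : R, 0 <= K /\ pinf_convex_with p T K.
  exists (Num.max K0 0); rewrite le_max lexx orbT; split=> // n x.
  by rewrite (le_trans (hK0 n x))// ler_wpM2r ?powR_ge0// le_max lexx.
split; first by apply: lb_le_inf => [|c []//]; exists K.
move=> n x; have := powR_ge0 (\sum_(k < n) `|x k| `^ p) p^-1.
rewrite -/(lp_sum p x) le_eqVlt => /predU1P[x0|xp].
  by have := hK n x; rewrite -x0 !mulr0.
rewrite -ler_pdivrMr//; apply: lb_le_inf; first by exists K.
by move=> c [c0 hc]; rewrite ler_pdivrMr.
Qed.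

End OperatorConstants.

(** * The equivalence, and the factorization through the free Banach lattice *)

Lemma pinf_convex_of_factorization (R : realType) (p : R) (hp : 1 < p)
    (E : completeNormedModType R) (X : banachLatticeType R)
    (T : {linear E -> X}) :
  factors_through_upper_p_estimate p T -> pinf_convex p T.
Proof.
move=> [Y [phi [S [[C0 hC0] /bounded_op_nneg[L [L0 hL]] hS TE]]]].
have [K [K0 hK]] := lattice_hom_bounded hS.
have [C [Cge0 hC]] : exists C : R, 0 <= C /\ upper_p_estimate_with p Y C.
  exists (Num.max C0 0); rewrite le_max lexx orbT; split=> // n x.
  by rewrite (le_trans (hC0 n x))// ler_wpM2r ?powR_ge0// le_max lexx.
have p0 : 0 < p by exact: lt_trans hp.
(* [K] bounds [S], which is automatically continuous, [C] is the constant of the upper estimate and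
   [L] bounds [phi]; as [S] commutes with suprema of moduli, the three multiply. *)
exists (K * (C * L)) => n x.
have -> : sup_modulus (fun k => T (x k)) = S (sup_modulus (fun k => phi (x k))).
  rewrite lattice_hom_sup_modulus//.
  by apply: eq_bigr => k _; rewrite TE.
rewrite (le_trans (hK _))// -!mulrA ler_wpM2l//.
rewrite (le_trans (hC _ _))// ler_wpM2l//.
(* Writing [L] as $(L^p)^{1/p}$ brings it under the root, where the sums compare termwise. *)
rewrite /lp_sum -[in leRHS](powRK hp L0).
rewrite -powRM ?powR_ge0 ?sumr_ge0//.
rewrite ge0_ler_powR ?nnegrE ?invr_ge0 ?(ltW p0) ?mulr_ge0 ?powR_ge0 ?sumr_ge0//.
rewrite mulr_sumr ler_sum// => k _.
by rewrite -powRM// ge0_ler_powR ?nnegrE ?(ltW p0) ?mulr_ge0.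
Qed.

Theorem corollary9p37 (R : realType) (p : R) (hp : 1 < p) :
  (forall (E : completeNormedModType R) (X : banachLatticeType R)
          (T : {linear E -> X}), bounded_op T ->
     pinf_convex p T <-> factors_through_upper_p_estimate p T) /\
  (exists kappa : R,
     forall (E : completeNormedModType R) (X : banachLatticeType R)
            (T : {linear E -> X}), bounded_op T -> pinf_convex p T ->
     forall (Z : banachLatticeType R) (psi : {linear E -> Z}),
       is_FBL_up p psi ->
       exists S : {linear Z -> X},
         [/\ lattice_hom S,
             forall x, S (psi x) = T x,
             forall S' : {linear Z -> X}, lattice_hom S' ->
               (forall x, S' (psi x) = T x) -> forall z, S' z = S z,
             bounded_op S &
             opnorm S <= kappa * pinf_const p T]).
Proof.
split=> [E X T _|].
  split=> [/pinf_constP[K0 hK]|]; last exact: pinf_convex_of_factorization.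
  have [Y [phi [S [hY hphi hS _ TE]]]] := pinf_convex_factorization hp K0 hK.
  exists Y, phi, S; split=> //; first by exists 1.
  by exists 1 => x; rewrite mul1r.
exists 1 => E X T _ /pinf_constP[K0 hK] Z psi [_ _ dpsi univ].
have [Y [phi [S [hY hphi hS SK TE]]]] := pinf_convex_factorization hp K0 hK.
have bphi : bounded_op phi by exists 1 => x; rewrite mul1r.
have [V [hV Vpsi bV nV]] := univ Y phi hY bphi.
(* The equality of norms transfers the contractivity of [phi] to [V], so composing with [S] costs no
   factor beyond the constant of [T]. *)
have V1 z : `|V z| <= `|z|.
  rewrite (le_trans (opnorm_bound z bV))// ler_piMl// nV opnorm_le// => x.
  by rewrite mul1r.
have SVle z : `|(S \o V) z| <= pinf_const p T * `|z|.
  by rewrite (le_trans (SK _))// ler_wpM2l.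
have hSV : lattice_hom (S \o V).
  split=> x y /=.
    by rewrite (proj1 hV) (proj1 hS).
  by rewrite (proj2 hV) (proj2 hS).
exists (S \o V); split=> //.
- by move=> x /=; rewrite Vpsi -TE.
- move=> S' hS' S'psi; apply: (lattice_hom_eq_dense hS' hSV dpsi).
  by move=> _ [x _ <-] /=; rewrite S'psi Vpsi -TE.
- by exists (pinf_const p T).
- by rewrite mul1r; apply: opnorm_le.
Qed.
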